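(* $\mathsf{GL}$ is complete for finitary provability models: if $A\in\mathcal L_\Box$ holds at every world of every finitary provability model, then $\mathsf{GL}\vdash A$.
   Context: $\mathsf{GL}$ is $\mathsf K$ plus $\Box A\to\Box\Box A$ and $\Box(\Box A\to A)\to\Box A$. Language $\mathcal L_\Box$: formulas built from atomic propositions and $\bot$ using $\to$ and a unary $\Box$. A formula is purely modal if it is a Boolean combination of formulas $\Box B$. A theory is a pair of a set of axioms and a set of inference rules (finitely many premises, one conclusion); $\mathsf T\vdash A$ means derivability. A theory is classical if modus ponens is one of its rules and all classical tautologies are derivable. A provability pre-model is $\mathcal P=(W,\sqsubset,\{L_w\}_{w\in W^\sqsubset},V)$ with $W$ nonempty, $\sqsubset$ a binary relation on $W$, $V\subseteq W\times\mathrm{atoms}$, $W^\sqsubset=\{u:\exists v\,(v\sqsubset u)\}$, and a theory $L_w$ for each $w\in W^\sqsubset$. Satisfaction: atoms via $V$, $\bot$ never holds, $\to$ classical, $\mathcal P,w\Vdash\Box A$ iff $L_u\vdash A$ for all $u$ with $w\sqsubset u$. With $\sqsubset^+$ the transitive closure, $\mathcal P,w\Vdash^+A$ iff there is $u\sqsubset w$ with $\mathcal P,v\Vdash A$ for all $v$ with $u\sqsubset^+v$. A provability model is a pre-model in which every $L_w$ is classical and modal completeness holds: for every $w\in W^\sqsubset$ and purely modal $A$, $\mathcal P,w\Vdash^+A$ implies $L_w\vdash A$. Necessitation: every $L_w$ has the rule ''from $A$ infer $\Box A$''. $\mathcal P\subseteq\mathcal P'$: same $W,\sqsubset,V$ and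 every theorem of $L_w$ is a theorem of $L'_w$. A pre-model is bi-finite if $W$ is finite and each $L_w$ has finitely many axioms and no rules. Tree: whenever $w\sqsubset v$ and $u\sqsubset v$, either $w=u$, $w\sqsubset^+u$ or $u\sqsubset^+w$; converse well-founded: no infinite chain $w_0\sqsubset w_1\sqsubset\cdots$. For a converse well-founded tree pre-model $\mathcal P$ there is a provability model with necessitation $\bar{\mathcal P}\supseteq\mathcal P$ that is $\subseteq$-minimal among provability models with necessitation containing $\mathcal P$ (unique up to having the same frame, valuation and sets of theorems); it is called the model generated by $\mathcal P$. A provability model is finitary if it is generated by a bi-finite converse well-founded tree pre-model. *)

(* Defs.v *)
From Stdlib Require Import List Bool Relations Wellfounded Classical ClassicalEpsilon.
Import ListNotations.

(** * Formulas *)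

Inductive form : Type :=
| Atom : nat -> form
| Bot : form
| Imp : form -> form -> form
| Box : form -> form.

Fixpoint purely_modal (A : form) : Prop :=
  match A with
  | Atom _ => False
  | Bot => True
  | Imp B C => purely_modal B /\ purely_modal C
  | Box _ => True
  end.

(** Boolean evaluation in which atoms and boxed formulas are the propositional
    variables; [v] is only consulted on formulas of these two shapes. *)
Fixpoint beval (v : form -> bool) (A : form) : bool :=
  match A with
  | Atom _ | Box _ => v A
  | Bot => false
  | Imp B C => implb (beval v B) (beval v C)
  end.

Definition tautology (A : form) : Prop := forall v, beval v A = true.

(** * Theories *)

(** An inference rule is a finite list of premises together with a conclusion;
    schematic rules such as modus ponens stand for the set of all their
    instances. *)
Record theory : Type := Theory {
  axioms : form -> Prop;
  rules : list form -> form -> Prop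
}.

Inductive derivable (T : theory) : form -> Prop :=
| der_axiom A : axioms T A -> derivable T A
| der_rule Gamma A :
    rules T Gamma A -> (forall B, In B Gamma -> derivable T B) -> derivable T A.

Definition has_mp (T : theory) : Prop := forall A B, rules T [A; Imp A B] B.

Definition has_nec (T : theory) : Prop := forall A, rules T [A] (Box A).

Definition classical (T : theory) : Prop :=
  has_mp T /\ forall A, tautology A -> derivable T A.

Definition theory_le (T T' : theory) : Prop :=
  forall A, derivable T A -> derivable T' A.

Inductive GL_axiom : form -> Prop :=
| GL_taut A : tautology A -> GL_axiom A
| GL_K A B : GL_axiom (Imp (Box (Imp A B)) (Imp (Box A) (Box B)))
| GL_4 A : GL_axiom (Imp (Box A) (Box (Box A)))
| GL_Lob A : GL_axiom (Imp (Box (Imp (Box A) A)) (Box A)).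

Inductive GL_rule : list form -> form -> Prop :=
| GL_mp A B : GL_rule [A; Imp A B] B
| GL_nec A : GL_rule [A] (Box A).

Definition GL : theory := Theory GL_axiom GL_rule.

(** * Provability pre-models *)

(** The components [(W, ⊏, V)] shared by pre-models that are compared by
    inclusion. *)
Record vframe : Type := VFrame {
  world : Type;
  world_inh : inhabited world;
  acc : world -> world -> Prop;
  val : world -> nat -> Prop
}.

(** [W^⊏], the worlds having a predecessor: only these carry a theory. *)
Definition succ_world (F : vframe) : Type :=
  { w : world F | exists v, acc F v w }.

Definition premodel (F : vframe) : Type := succ_world F -> theory.

Definition acc_plus (F : vframe) : world F -> world F -> Prop :=
  clos_trans (world F) (acc F).

Fixpoint sat {F : vframe} (P : premodel F) (w : world F) (A : form) : Prop :=
  match A with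
  | Atom p => val F w p
  | Bot => False
  | Imp B C => sat P w B -> sat P w C
  | Box B => forall u : succ_world F, acc F w (proj1_sig u) -> derivable (P u) B
  end.

Definition sat_plus {F : vframe} (P : premodel F) (w : world F) (A : form) : Prop :=
  exists u, acc F u w /\ forall v, acc_plus F u v -> sat P v A.

Definition modally_complete {F : vframe} (P : premodel F) : Prop :=
  forall (w : succ_world F) (A : form),
    purely_modal A -> sat_plus P (proj1_sig w) A -> derivable (P w) A.

Definition provability_model {F : vframe} (P : premodel F) : Prop :=
  (forall w, classical (P w)) /\ modally_complete P.

Definition necessitation {F : vframe} (P : premodel F) : Prop :=
  forall w, has_nec (P w).

Definition premodel_le {F : vframe} (P P' : premodel F) : Prop :=
  forall w, theory_le (P w) (P' w).

Definition tree (F : vframe) : Prop :=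
  forall w u v, acc F w v -> acc F u v -> w = u \/ acc_plus F w u \/ acc_plus F u w.

Definition converse_well_founded (F : vframe) : Prop :=
  ~ exists f : nat -> world F, forall n, acc F (f n) (f (S n)).

Definition bi_finite {F : vframe} (P : premodel F) : Prop :=
  (exists l : list (world F), forall w, In w l) /\
  (forall w, (exists l : list form, forall A, axioms (P w) A <-> In A l) /\
             (forall Gamma A, ~ rules (P w) Gamma A)).

(** * Generated models *)

Definition nec_model_over {F : vframe} (P Q : premodel F) : Prop :=
  provability_model Q /\ necessitation Q /\ premodel_le P Q.

Definition minimal_over {F : vframe} (P Q : premodel F) : Prop :=
  forall Q', nec_model_over P Q' -> premodel_le Q' Q -> premodel_le Q Q'.

(** Satisfaction is not monotone in the theories, so enlarging the theory of a
    world changes what modal completeness demands lower down. As a result there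
    is in general no [premodel_le]-least model over [P], and the
    [premodel_le]-minimal ones are not unique: on the chain [t ⊏ u ⊏ w] with
    empty theories, the model generated by adding the axiom [p] at [w] is again
    minimal, since without [p] at [w] the theory of [u] has to prove
    [□p → □⊥]. The model generated by [P] is the minimal one in which no world
    proves more than it must, given its own satisfaction relation; it is unique
    by [generated_unique] below, and [minimal_over] follows from this condition
    by [worldwise_least_minimal]. *)
Definition worldwise_least_over {F : vframe} (P Q : premodel F) : Prop :=
  forall (w : succ_world F) (T : theory),
    classical T -> has_nec T -> theory_le (P w) T ->
    (forall A, purely_modal A -> sat_plus Q (proj1_sig w) A -> derivable T A) ->
    theory_le (Q w) T.

Definition generated_by {F : vframe} (P Q : premodel F) : Prop :=
  nec_model_over P Q /\ minimal_over P Q /\ worldwise_least_over P Q.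

Definition finitary {F : vframe} (Q : premodel F) : Prop :=
  exists P : premodel F,
    bi_finite P /\ converse_well_founded F /\ tree F /\ generated_by P Q.

(** * Uniqueness of the generated model *)

Lemma cwf_well_founded F :
  converse_well_founded F -> well_founded (fun x y => acc F y x).
Proof.
intros Hcwf w0; apply NNPP; intro H0; apply Hcwf.
set (R := fun x y => acc F y x).
assert (step : forall x : {x | ~ Acc R x},
          {y : {x | ~ Acc R x} | acc F (proj1_sig x) (proj1_sig y)}).
{ intros [x Hx]; apply constructive_indefinite_description.
  apply NNPP; intro Hn; apply Hx; constructor; intros y Hy.
  apply NNPP; intro Hy'; apply Hn; now exists (exist _ y Hy'). }
set (g := fix g n := match n with
                     | 0 => exist _ w0 H0
                     | S n => proj1_sig (step (g n))
                     end).
exists (fun n => proj1_sig (g n)); intro n.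
exact (proj2_sig (step (g n))).
Qed.

Lemma cwf_well_founded_plus F :
  converse_well_founded F -> well_founded (fun x y => acc_plus F y x).
Proof.
intro Hcwf.
assert (Hwf := wf_clos_trans _ _ (cwf_well_founded F Hcwf)).
intro x; induction (Hwf x) as [x _ IH]; constructor; intros y Hy; apply IH.
clear IH; unfold acc_plus in Hy.
induction Hy as [a b Hab|a b c _ IH1 _ IH2].
- now apply t_step.
- now apply t_trans with b.
Qed.

Lemma max_pred F (w : succ_world F) :
  converse_well_founded F ->
  exists t, acc F t (proj1_sig w) /\
            forall u, acc F u (proj1_sig w) -> ~ acc_plus F t u.
Proof.
intro Hcwf; destruct w as [w [v Hv]]; simpl.
induction (cwf_well_founded_plus F Hcwf v) as [v _ IH].
destruct (classic (exists u, acc F u w /\ acc_plus F v u)) as [[u [Hu Hvu]]|Hn].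
- now apply IH with u.
- exists v; split; [exact Hv|]; intros u Hu Hvu; apply Hn; now exists u.
Qed.

Lemma agreement F (Q Q' : premodel F) :
  converse_well_founded F -> tree F ->
  (forall w, (forall A, sat_plus Q (proj1_sig w) A <-> sat_plus Q' (proj1_sig w) A) ->
             forall A, derivable (Q w) A <-> derivable (Q' w) A) ->
  forall w A, derivable (Q w) A <-> derivable (Q' w) A.
Proof.
intros Hcwf Htree Hstep.
assert (main : forall t (w : succ_world F), acc F t (proj1_sig w) ->
          (forall u, acc F u (proj1_sig w) -> ~ acc_plus F t u) ->
          forall A, derivable (Q w) A <-> derivable (Q' w) A).
{ intro t; induction (cwf_well_founded_plus F Hcwf t) as [t _ IH].
  intros w Htw Hmax.
  assert (Hsat : forall v, acc_plus F t v -> forall A, sat Q v A <-> sat Q' v A).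
  { intros v Htv A; induction A as [p| |B IHB C IHC|B _]; simpl; try tauto.
    assert (E : forall x : succ_world F, acc F v (proj1_sig x) ->
              (derivable (Q x) B <-> derivable (Q' x) B)).
    { intros x Hvx; destruct (max_pred F x Hcwf) as [m [Hm Hmmax]].
      apply IH with m; auto.
      destruct (Htree v m _ Hvx Hm) as [->|[H|H]]; auto.
      - now apply t_trans with v.
      - now destruct (Hmmax v). }
    split; intros H x Hx; apply E; auto. }
  assert (Hbelow : forall u v, acc F u (proj1_sig w) ->
            acc_plus F t v -> acc_plus F u v).
  { intros u v Hu Htv; destruct (Htree u t _ Hu Htw) as [->|[H|H]]; auto.
    - now apply t_trans with t.
    - now destruct (Hmax u). }
  apply Hstep; intro A; split; intros [u [Hu HA]]; exists t; split; auto;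
    intros v Hv; apply (Hsat v Hv); apply HA; eauto. }
intro w; destruct (max_pred F w Hcwf) as [t [Ht Hmax]]; now apply main with t.
Qed.

Lemma worldwise_least_minimal F (P Q : premodel F) :
  converse_well_founded F -> tree F ->
  worldwise_least_over P Q -> minimal_over P Q.
Proof.
intros Hcwf Htree HQ Q' [[Hcl Hmc] [Hnec HP]] Hle w A; apply (agreement F Q Q'); auto.
clear w A; intros w Hw A; split; [|exact (Hle w A)].
apply HQ; auto; intros B HB HwB; apply Hmc; auto; now apply Hw.
Qed.

Lemma generated_unique F (P Q Q' : premodel F) :
  converse_well_founded F -> tree F ->
  generated_by P Q -> generated_by P Q' ->
  premodel_le Q Q' /\ premodel_le Q' Q.
Proof.
intros Hcwf Htree [[[Hcl Hmc] [Hnec HP]] [_ HQ]] [[[Hcl' Hmc'] [Hnec' HP']] [_ HQ']].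
assert (E : forall w A, derivable (Q w) A <-> derivable (Q' w) A).
{ apply (agreement F Q Q'); auto; intros w Hw A; split.
  - apply HQ; auto; intros B HB HwB; apply Hmc'; auto; now apply Hw.
  - apply HQ'; auto; intros B HB HwB; apply Hmc; auto; now apply Hw. }
split; intros w A; apply E.
Qed.

(* Main.v *)
From Stdlib Require Import List Bool Arith Lia Relations.
From Stdlib Require Import Classical ClassicalEpsilon FunctionalExtensionality.
Require Import Defs.
Import ListNotations.

(** If GL does not prove A, unravel the canonical model over the subformulas of A
    into a finite tree: worlds are the nonempty chains of maximal consistent sets,
    each set strictly above the previous one, and the children of a chain p carry
    as axioms the formulas B with Box B in the last set of p.  In the model
    generated by these axioms, truth at p of a subformula of A is membership in
    the last set of p.  The point is that a child of p proves no subformula B of A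
    whose box is not in the last set of p.  Truth above p is not preserved by
    necessitation, so one shows more by induction on derivations: every theorem of
    a child of p is true at all worlds above p and is also a theorem of all
    children of these worlds. *)

(** * The generated model *)

(** [GL_rule] contributes just modus ponens and necessitation; K, 4 and Löb are not put in as
    axioms. *)
Definition nec_closure (ax : form -> Prop) : theory :=
  Theory (fun A => tautology A \/ ax A) GL_rule.

Lemma derivable_mp (T : theory) (A B : form) :
  has_mp T -> derivable T A -> derivable T (Imp A B) -> derivable T B.
Proof.
intros Hmp HA HAB; apply der_rule with (1 := Hmp A B).
now intros C [<-|[<-|[]]].
Qed.

Lemma derivable_nec (T : theory) (A : form) :
  has_nec T -> derivable T A -> derivable T (Box A).
Proof.
intros Hnec HA; apply der_rule with (1 := Hnec A).
now intros C [<-|[]].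
Qed.

Lemma derivable_GL_rule_ind (T : theory) (D : form -> Prop) :
  (forall Gamma A, rules T Gamma A -> GL_rule Gamma A) ->
  (forall A, axioms T A -> D A) ->
  (forall A B, D A -> D (Imp A B) -> D B) ->
  (forall A, D A -> D (Box A)) ->
  forall A, derivable T A -> D A.
Proof.
intros Hrules Hax Hmp Hnec A HA; induction HA as [A HA|Gamma A HA _ IH]; auto.
destruct (Hrules _ _ HA) as [A B|A].
- apply Hmp with A; apply IH; simpl; auto.
- apply Hnec, IH; simpl; auto.
Qed.

Lemma nec_closure_classical (ax : form -> Prop) : classical (nec_closure ax).
Proof.
split.
- intros A B; constructor.
- intros A HA; apply der_axiom; now left.
Qed.

Lemma nec_closure_nec (ax : form -> Prop) : has_nec (nec_closure ax).
Proof. intro A; constructor. Qed.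

Lemma nec_closure_least (ax : form -> Prop) (T : theory) :
  classical T -> has_nec T -> (forall A, ax A -> derivable T A) ->
  theory_le (nec_closure ax) T.
Proof.
intros [Hmp Htaut] Hnec Hax; intro A; apply derivable_GL_rule_ind; auto.
- intros B [HB|HB]; auto.
- intros B C; now apply derivable_mp.
- intro B; now apply derivable_nec.
Qed.

Lemma nec_closure_mono (ax ax' : form -> Prop) :
  (forall A, ax A -> ax' A) -> theory_le (nec_closure ax) (nec_closure ax').
Proof.
intro H; apply nec_closure_least.
- apply nec_closure_classical.
- apply nec_closure_nec.
- intros A HA; apply der_axiom; right; auto.
Qed.

(** Boxes are handed to [D], because their truth depends on theories at other worlds and not on
    satisfaction of smaller formulas here. *)
Fixpoint sat_box (val : nat -> Prop) (D : form -> Prop) (A : form) : Prop :=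
  match A with
  | Atom p => val p
  | Bot => False
  | Imp B C => sat_box val D B -> sat_box val D C
  | Box B => D B
  end.

(* Satisfaction at [u] in the generated model, as a function of satisfaction [rec]
   strictly above [u].  In a tree the restriction to [acc_plus F u v] is harmless:
   if [t] lies below [u], the requirement for [t] implies the one for [u]. *)
Definition gen_sat_step {F : vframe} (P : premodel F) (u : world F)
    (rec : forall v, acc_plus F u v -> form -> Prop) : form -> Prop :=
  sat_box (val F u) (fun B =>
    forall w : succ_world F, acc F u (proj1_sig w) ->
      derivable (nec_closure (fun C =>
        derivable (P w) C \/
        (purely_modal C /\
         exists t, acc F t (proj1_sig w) /\
           forall v (Huv : acc_plus F u v), acc_plus F t v -> rec v Huv C))) B).

(** Satisfaction at [u] refers to the theories of its successors, whose axioms refer to satisfaction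
    strictly above [u]. Recursion from the top worlds downwards resolves the circularity. *)
Definition gen_sat {F : vframe} (P : premodel F) (Hcwf : converse_well_founded F) :
    world F -> form -> Prop :=
  Fix (cwf_well_founded_plus F Hcwf) (fun _ => form -> Prop) (gen_sat_step P).

Definition gen_model {F : vframe} (P : premodel F) (Hcwf : converse_well_founded F) :
    premodel F :=
  fun w => nec_closure (fun C =>
    derivable (P w) C \/
    (purely_modal C /\
     exists t, acc F t (proj1_sig w) /\
       forall v, acc_plus F t v -> gen_sat P Hcwf v C)).

Lemma gen_sat_eq {F : vframe} (P : premodel F) (Hcwf : converse_well_founded F)
    (u : world F) :
  gen_sat P Hcwf u = gen_sat_step P u (fun v _ => gen_sat P Hcwf v).
Proof.
unfold gen_sat; rewrite Fix_eq; auto.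
intros x f g Hfg; f_equal.
now extensionality y; extensionality p.
Qed.

Lemma gen_satE {F : vframe} (P : premodel F) (Hcwf : converse_well_founded F)
    (u : world F) (A : form) :
  tree F -> gen_sat P Hcwf u A <-> sat (gen_model P Hcwf) u A.
Proof.
intro Htree; rewrite gen_sat_eq; unfold gen_sat_step.
induction A as [p| |B IHB C IHC|B _]; simpl; try tauto.
split; intros H w Hw; generalize (H w Hw); apply nec_closure_mono;
  (intros C [HC|[HC [t [Ht HtC]]]]; [now left|right; split; [exact HC|]]).
(* For [t] equal to or above [u] the restriction to worlds above [u] holds automatically; for [t]
   below [u], the witness is [u] itself. *)
- destruct (Htree t u _ Ht Hw) as [<-|[Htu|Hut]].
  + exists t; auto.
  + exists u; split; [exact Hw|]; intros v Huv; apply HtC; auto.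
    now apply t_trans with u.
  + exists t; split; [exact Ht|]; intros v Htv; apply HtC; auto.
    now apply t_trans with t.
- exists t; auto.
Qed.

(** Besides tautologies, the axioms at [w] are just what every competing theory must derive:
    theorems of [P w] and instances of modal completeness. Worldwise leastness is then immediate. *)
Lemma gen_model_generated {F : vframe} (P : premodel F) (Hcwf : converse_well_founded F) :
  tree F -> generated_by P (gen_model P Hcwf).
Proof.
intro Htree.
assert (Hleast : worldwise_least_over P (gen_model P Hcwf)).
{ intros w T Hcl Hnec HP Hmod; apply nec_closure_least; auto.
  intros A [HA|[HA [t [Ht HtA]]]]; [now apply HP|].
  apply Hmod; auto; exists t; split; auto.
  intros v Hv; apply gen_satE; auto. }
split; [split; [split|split]|split].
- intro w; apply nec_closure_classical.
- intros w A HA [t [Ht HtA]]; apply der_axiom; right; right; split; auto.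
  exists t; split; auto; intros v Hv; apply gen_satE; auto.
- intro w; apply nec_closure_nec.
- intros w A HA; apply der_axiom; right; now left.
- now apply worldwise_least_minimal.
- exact Hleast.
Qed.

(** The formulas with both properties are closed under modus ponens and necessitation and include
    all that [w] is forced to prove, so leastness applies. The unique parent [p] makes modal
    completeness at [w] speak of the worlds above [p]. *)
Lemma generated_theorems_persist {F : vframe} (P Q : premodel F) (p : world F)
    (w : succ_world F) :
  generated_by P Q ->
  (forall t, acc F t (proj1_sig w) -> t = p) ->
  (forall B, derivable (P w) B -> forall v, acc_plus F p v ->
     sat Q v B /\
     forall u : succ_world F, acc F v (proj1_sig u) -> derivable (P u) B) ->
  forall B, derivable (Q w) B -> forall v, acc_plus F p v ->
    sat Q v B /\
    forall u : succ_world F, acc F v (proj1_sig u) -> derivable (Q u) B.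
Proof.
intros [[[Hcl Hmc] [Hnec HPQ]] [_ Hleast]] Hpar HP.
set (D := fun B => forall v, acc_plus F p v -> sat Q v B /\
  forall u : succ_world F, acc F v (proj1_sig u) -> derivable (Q u) B).
change (forall B, derivable (Q w) B -> D B); intros B HB.
assert (HD : derivable (nec_closure D) B).
{ revert B HB; apply Hleast.
  - apply nec_closure_classical.
  - apply nec_closure_nec.
  - intros B HB; apply der_axiom; right; intros v Hv.
    destruct (HP B HB v Hv) as [H1 H2]; split; auto; intros u Hu; apply HPQ; auto.
  - intros B HB [t [Ht HtB]]; apply der_axiom; right; intros v Hv.
    (* A purely modal formula true everywhere above [p] is true everywhere above [v], so modal
       completeness at the children of [v] yields it. *)
    rewrite (Hpar t Ht) in HtB; split; auto.
    intros u Hu; apply Hmc; auto; exists v; split; auto.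
    intros x Hx; apply HtB; now apply t_trans with v. }
revert HD; apply derivable_GL_rule_ind; auto.
- intros C [HC|HC]; auto; intros v Hv; split.
  (* Truth at [v], read as a Boolean valuation of atoms and boxed formulas, makes tautologies
     true. *)
  + set (b := fun C => if excluded_middle_informative (sat Q v C) then true else false).
    assert (Hb : forall E, beval b E = true <-> sat Q v E).
    { induction E as [q| |E1 IH1 E2 IH2|E _]; simpl beval.
      - unfold b; destruct excluded_middle_informative; split; easy.
      - easy.
      - simpl; rewrite <- IH1, <- IH2; destruct (beval b E1), (beval b E2); simpl;
          intuition congruence.
      - unfold b; destruct excluded_middle_informative; split; easy. }
    apply Hb, HC.
  + intros u _; now apply (Hcl u).
- intros C E HC HCE v Hv; destruct (HC v Hv) as [H1 H2], (HCE v Hv) as [H3 H4].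
  split; [now apply H3|]; intros u Hu; apply derivable_mp with C; auto; apply Hcl.
(* The second property of [C] is literally the truth of [Box C] at [v]. *)
- intros C HC v Hv; destruct (HC v Hv) as [H1 H2]; split; [exact H2|].
  intros u Hu; apply derivable_nec; auto.
Qed.

(** * Derivability in GL from finitely many hypotheses *)

Definition Neg (A : form) : form := Imp A Bot.

(** Hypotheses are antecedents of a theorem, so necessitation never applies to them. *)
Definition entails (Gamma : list form) (C : form) : Prop :=
  derivable GL (fold_right Imp C Gamma).

Definition consistent (Gamma : list form) : Prop := ~ entails Gamma Bot.

Lemma GL_has_mp : has_mp GL.
Proof. intros A B; constructor. Qed.

Lemma GL_has_nec : has_nec GL.
Proof. intro A; constructor. Qed.

Lemma beval_imps (v : form -> bool) (Gamma : list form) (C : form) :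
  beval v (fold_right Imp C Gamma) = true <->
  ((forall B, In B Gamma -> beval v B = true) -> beval v C = true).
Proof.
induction Gamma as [|B Gamma IH]; simpl; [firstorder|].
destruct (beval v B) eqn:HB; simpl.
- rewrite IH; split; intros H H'; apply H; auto.
  intros E [<-|HE]; auto.
- split; auto; intros _ H; rewrite (H B) in HB; [discriminate|auto].
Qed.

(** This replaces propositional Hilbert derivations by truth-value computations: the nested
    implication is a tautology, and modus ponens strips its antecedents. *)
Lemma GL_taut_consequence (Ds : list form) (C : form) :
  (forall D, In D Ds -> derivable GL D) ->
  (forall v, (forall D, In D Ds -> beval v D = true) -> beval v C = true) ->
  derivable GL C.
Proof.
intros HDs Hv.
assert (H : derivable GL (fold_right Imp C Ds)).
{ apply der_axiom, GL_taut; intro v; apply beval_imps; auto. }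
clear Hv; induction Ds as [|D Ds IH]; auto.
apply IH; [simpl in HDs; auto|].
apply derivable_mp with D; [apply GL_has_mp|apply HDs; simpl; auto|exact H].
Qed.

Lemma entails_taut_consequence (Gamma Ds : list form) (C : form) :
  (forall D, In D Ds -> entails Gamma D) ->
  (forall v, (forall B, In B Gamma -> beval v B = true) ->
     (forall D, In D Ds -> beval v D = true) -> beval v C = true) ->
  entails Gamma C.
Proof.
intros HDs Hv.
apply GL_taut_consequence with (map (fun D => fold_right Imp D Gamma) Ds).
- intros E HE; apply in_map_iff in HE; destruct HE as [D [<- HD]]; now apply HDs.
- intros v HvD; apply beval_imps; intro HG; apply Hv; auto.
  intros D HD; apply (beval_imps v Gamma D); auto.
  apply HvD, in_map_iff; now exists D.
Qed.

Lemma entails_in (Gamma : list form) (C : form) : In C Gamma -> entails Gamma C.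
Proof.
intro HC; apply entails_taut_consequence with []; [easy|]; auto.
Qed.

Lemma entails_theorem (Gamma : list form) (C : form) :
  derivable GL C -> entails Gamma C.
Proof.
intro HC; apply GL_taut_consequence with [C].
- now intros D [<-|[]].
- intros v Hv; apply beval_imps; intros _; apply Hv; simpl; auto.
Qed.

Lemma entails_mp (Gamma : list form) (B C : form) :
  entails Gamma B -> entails Gamma (Imp B C) -> entails Gamma C.
Proof.
intros HB HBC; apply entails_taut_consequence with [B; Imp B C].
- now intros D [<-|[<-|[]]].
- intros v _ Hv; assert (H1 := Hv B); assert (H2 := Hv (Imp B C)); simpl in *.
  rewrite H1 in H2; auto.
Qed.

Lemma entails_incl (Gamma Delta : list form) (C : form) :
  incl Gamma Delta -> entails Gamma C -> entails Delta C.
Proof.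
intros Hincl HC; apply GL_taut_consequence with [fold_right Imp C Gamma].
- now intros D [<-|[]].
- intros v Hv; apply beval_imps; intro HD; apply (beval_imps v Gamma C); auto.
  apply Hv; simpl; auto.
Qed.

Lemma entails_cut (Gamma Delta : list form) (C : form) :
  (forall B, In B Gamma -> entails Delta B) -> entails Gamma C -> entails Delta C.
Proof.
intros HG HC; apply entails_taut_consequence with (fold_right Imp C Gamma :: Gamma).
- intros D [<-|HD]; auto; now apply entails_theorem.
- intros v _ Hv; apply (beval_imps v Gamma C); simpl in Hv; auto.
Qed.

Lemma entails_nec (Gamma : list form) (C : form) :
  entails Gamma C -> entails (map Box Gamma) (Box C).
Proof.
intro HC; assert (HbC : derivable GL (Box (fold_right Imp C Gamma)))
  by now apply derivable_nec; [apply GL_has_nec|].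
apply (entails_theorem (map Box Gamma)) in HbC; clear HC; revert HbC.
assert (Hsub : incl Gamma Gamma) by apply incl_refl.
(* Only the antecedents under the box become [Delta], to be peeled off with K; the hypotheses
   [map Box Gamma] stay fixed. *)
revert Hsub; generalize Gamma at 1 4; intro Delta.
induction Delta as [|B Delta IH]; intro Hsub; simpl; auto.
intro HbC; apply IH; [intros E HE; apply Hsub; simpl; auto|].
apply entails_mp with (Box B).
- apply entails_in, in_map, Hsub; simpl; auto.
- apply entails_mp with (1 := HbC), entails_theorem, der_axiom, GL_K.
Qed.

Lemma consistent_extend (Gamma : list form) (B : form) :
  consistent Gamma -> consistent (B :: Gamma) \/ consistent (Neg B :: Gamma).
Proof.
intro HG; apply NNPP; intro H; apply not_or_and in H; destruct H as [H1 H2].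
apply NNPP in H1; apply NNPP in H2; apply HG.
apply GL_taut_consequence
  with [fold_right Imp Bot (B :: Gamma); fold_right Imp Bot (Neg B :: Gamma)].
- now intros D [<-|[<-|[]]].
- intros v Hv; assert (E1 := Hv _ (or_introl eq_refl)).
  assert (E2 := Hv _ (or_intror (or_introl eq_refl))).
  simpl in *; destruct (beval v B), (beval v (fold_right Imp Bot Gamma)); auto.
Qed.

Lemma lindenbaum (S Gamma : list form) :
  consistent Gamma ->
  exists Delta, consistent Delta /\ incl Gamma Delta /\
    forall B, In B S -> In B Delta \/ In (Neg B) Delta.
Proof.
intro HG; induction S as [|B S [Delta [HD [Hincl HS]]]].
- exists Gamma; repeat split; auto; [apply incl_refl|easy].
- destruct (consistent_extend Delta B HD) as [H|H]; eexists;
    (split; [exact H|split; [now apply incl_tl|]]);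
    (intros C [<-|HC]; [|destruct (HS C HC)]; simpl; auto).
Qed.

(** * Maximal consistent sets of subformulas *)

Lemma form_eq_dec (A B : form) : {A = B} + {A <> B}.
Proof. decide equality; apply Nat.eq_dec. Qed.

Fixpoint subforms (A : form) : list form :=
  A :: match A with
       | Atom _ | Bot => []
       | Imp B C => subforms B ++ subforms C
       | Box B => subforms B
       end.

Definition subform_closed (S : list form) : Prop :=
  (forall B C, In (Imp B C) S -> In B S /\ In C S) /\
  (forall B, In (Box B) S -> In B S).

Lemma subforms_refl (A : form) : In A (subforms A).
Proof. destruct A; simpl; auto. Qed.

Lemma subforms_closed (A : form) : subform_closed (subforms A).
Proof.
induction A as [p| |A1 [IH1 IH1'] A2 [IH2 IH2']|A [IH IH']];
  split; intros; simpl in *.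
all: repeat match goal with
  | H : _ \/ _ |- _ => destruct H
  | H : In _ (_ ++ _) |- _ => apply in_app_or in H
  | H : False |- _ => destruct H
  | H : Imp _ _ = _ |- _ => inversion H; clear H; subst
  | H : Box _ = _ |- _ => inversion H; clear H; subst
  | H : Bot = _ |- _ => inversion H
  | H : Atom _ = _ |- _ => inversion H
  end.
all: rewrite ?in_app_iff.
all: try solve [auto using subforms_refl].
all: try (destruct (IH1 _ _ H); auto).
all: try (destruct (IH2 _ _ H); auto).
all: try (destruct (IH _ _ H); auto).
all: eauto 6 using subforms_refl.
Qed.

Definition signed (S X : list form) : list form :=
  map (fun B => if in_dec form_eq_dec B X then B else Neg B) S.

(** Maximality is relative to [S]: [signed] decides each of its members. Taking [X] as a filter of
    [S] fixes order and repetitions, so only finitely many such lists exist. *)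
Definition mcs (S X : list form) : Prop :=
  (exists g, X = filter g S) /\ consistent (signed S X).

Lemma mcs_incl (S X : list form) : mcs S X -> incl X S.
Proof. intros [[g ->] _] B HB; now apply filter_In in HB. Qed.

Lemma mcs_entails_in (S X : list form) (B : form) :
  mcs S X -> In B X -> entails (signed S X) B.
Proof.
intros HX HB; apply entails_in, in_map_iff; exists B; split.
- now destruct in_dec.
- now apply (mcs_incl S X).
Qed.

Lemma mcs_entails_notin (S X : list form) (B : form) :
  In B S -> ~ In B X -> entails (signed S X) (Neg B).
Proof.
intros HB HBX; apply entails_in, in_map_iff; exists B; split; auto.
now destruct in_dec.
Qed.

Lemma mcs_closed (S X : list form) (B : form) :
  mcs S X -> In B S -> entails (signed S X) B -> In B X.
Proof.
intros HX HB HXB; apply NNPP; intro HBX; apply (proj2 HX).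
apply entails_mp with (1 := HXB); now apply mcs_entails_notin.
Qed.

Lemma mcs_Bot (S X : list form) : mcs S X -> ~ In Bot X.
Proof. intros HX HB; apply (proj2 HX); now apply mcs_entails_in. Qed.

Lemma mcs_Imp (S X : list form) (B C : form) :
  mcs S X -> In (Imp B C) S -> In B S -> In C S ->
  In (Imp B C) X <-> (In B X -> In C X).
Proof.
intros HX HBC HB HC; split.
- intros H HBX; apply mcs_closed with S; auto.
  apply entails_mp with B; now apply mcs_entails_in.
- intro H; apply mcs_closed with S; auto.
  destruct (in_dec form_eq_dec B X) as [HBX|HBX].
  + apply entails_taut_consequence with [C].
    * intros D [<-|[]]; apply mcs_entails_in; auto.
    * intros v _ Hv; simpl; rewrite (Hv C); simpl; auto; apply implb_true_r.
  + apply entails_taut_consequence with [Neg B].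
    * intros D [<-|[]]; now apply mcs_entails_notin.
    * intros v _ Hv; assert (E := Hv (Neg B)); simpl in *.
      destruct (beval v B); simpl in *; auto; discriminate E; auto.
Qed.

Lemma mcs_exists (S Gamma : list form) :
  consistent Gamma ->
  exists X, mcs S X /\
    forall B, In B S -> (In B Gamma -> In B X) /\ (In (Neg B) Gamma -> ~ In B X).
Proof.
intro HG; destruct (lindenbaum S Gamma HG) as [Delta [HD [Hincl HS]]].
set (g := fun B => if in_dec form_eq_dec B Delta then true else false).
assert (Hg : forall B, In B (filter g S) <-> In B S /\ In B Delta).
{ intro B; rewrite filter_In; unfold g; destruct in_dec; intuition congruence. }
exists (filter g S); split; [split; [now exists g|]|].
- intro H; apply HD; revert H; apply entails_incl; intros B HB.
  apply in_map_iff in HB; destruct HB as [C [<- HC]]; destruct in_dec as [H|H].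
  + now apply Hg.
  + destruct (HS C HC); auto; destruct H; now apply Hg.
- intros B HB; rewrite Hg; split; [auto|].
  intros HBG [_ HBD]; apply HD; apply entails_mp with B; apply entails_in; auto.
Qed.

(** The usual accessibility of the finite canonical model of GL; the new box in [Y] makes it
    irreflexive and bounds the length of chains. *)
Definition mcs_lt (X Y : list form) : Prop :=
  (forall C, In (Box C) X -> In C Y /\ In (Box C) Y) /\
  exists B, In (Box B) Y /\ ~ In (Box B) X.

Definition unbox (X : list form) : list form :=
  flat_map (fun B => match B with Box C => [C] | _ => [] end) X.

Lemma unboxE (X : list form) (C : form) : In C (unbox X) <-> In (Box C) X.
Proof.
unfold unbox; rewrite in_flat_map; split.
- intros [[p| |B B'|B] [HB HC]]; simpl in HC; try easy.
  now destruct HC as [<-|[]].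
- intro HC; exists (Box C); simpl; auto.
Qed.

(** Löb's axiom at work: if the wanted set were inconsistent, [Gamma] would entail [Box B -> B],
    hence [X] would entail the box of this and so [Box B]. *)
Lemma mcs_successor (S X : list form) (B : form) :
  subform_closed S -> mcs S X -> In (Box B) S -> ~ In (Box B) X ->
  exists Y, mcs S Y /\ mcs_lt X Y /\ ~ In B Y.
Proof.
intros [_ HS] HX HB HBX.
set (Gamma := unbox X ++ map Box (unbox X)).
assert (HG : forall C, In (Box C) X -> In C Gamma /\ In (Box C) Gamma).
{ intros C HC; unfold Gamma; rewrite !in_app_iff; apply unboxE in HC.
  split; [now left|right; now apply in_map]. }
(* [Neg B] keeps [B] out of [Y]; [Box B] is the new box that makes [Y] strictly above [X]. *)
assert (Hcons : consistent (Neg B :: Box B :: Gamma)).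
{ intro H; apply HBX; apply mcs_closed with S; auto.
  assert (HL : entails Gamma (Imp (Box B) B)).
  { apply GL_taut_consequence with [fold_right Imp Bot (Neg B :: Box B :: Gamma)].
    - now intros D [<-|[]].
    - intros v Hv; apply beval_imps; intro HvG.
      assert (E := proj1 (beval_imps v (Neg B :: Box B :: Gamma) Bot)
                     (Hv _ (or_introl eq_refl))).
      simpl in E |- *; destruct (v (Box B)) eqn:E1, (beval v B) eqn:E2; auto.
      apply E; intros C [<-|[<-|HC]]; simpl; auto.
      now rewrite E2. }
  apply entails_nec in HL.
  apply entails_mp with (Box (Imp (Box B) B));
    [|apply entails_theorem, der_axiom, GL_Lob].
  (* Boxes of formulas in [unbox X] lie in [X]; boxes of the remaining, already boxed ones follow by
     axiom 4. *)
  revert HL; apply entails_cut; intros C HC.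
  apply in_map_iff in HC; destruct HC as [D [<- HD]].
  apply in_app_or in HD; destruct HD as [HD|HD].
  - apply unboxE in HD; now apply mcs_entails_in.
  - apply in_map_iff in HD; destruct HD as [E [<- HE]]; apply unboxE in HE.
    apply entails_mp with (Box E); [now apply mcs_entails_in|].
    apply entails_theorem, der_axiom, GL_4. }
destruct (mcs_exists S _ Hcons) as [Y [HY HYG]].
exists Y; split; [exact HY|split; [split|]].
- intros C HC; assert (HCS := mcs_incl S X HX _ HC).
  destruct (HG C HC) as [H1 H2]; split; apply HYG; simpl; auto.
- exists B; split; auto; apply HYG; simpl; auto.
- apply HYG; simpl; auto.
Qed.

(** * The tree of chains *)

(** Chains are stored with the highest set first, so extending a chain is consing and its parent is
    the tail. *)
Inductive chain (S : list form) : list (list form) -> Prop :=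
| chain_root X : mcs S X -> chain S [X]
| chain_step X Y p : mcs S Y -> mcs_lt X Y -> chain S (X :: p) -> chain S (Y :: X :: p).

Definition unboxed_count (S X : list form) : nat :=
  length (filter (fun B => if in_dec form_eq_dec (Box B) X then false else true) S).

Lemma filter_length_lt {T : Type} (f g : T -> bool) (l : list T) (x : T) :
  (forall y, f y = true -> g y = true) ->
  In x l -> g x = true -> f x = false ->
  length (filter f l) < length (filter g l).
Proof.
intros Hfg Hx Hgx Hfx.
assert (Hle : forall l, length (filter f l) <= length (filter g l)).
{ intro m; induction m as [|y m IH]; simpl; auto.
  destruct (f y) eqn:Hf; [rewrite (Hfg y Hf); simpl; lia|].
  destruct (g y); simpl; lia. }
induction l as [|y l IH]; simpl; [easy|].
destruct Hx as [->|Hx].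
- rewrite Hgx, Hfx; simpl; specialize (Hle l); lia.
- specialize (IH Hx); destruct (f y) eqn:Hf; [rewrite (Hfg y Hf); simpl; lia|].
  destruct (g y); simpl; lia.
Qed.

Lemma unboxed_count_lt (S X Y : list form) :
  subform_closed S -> mcs S Y -> mcs_lt X Y -> unboxed_count S Y < unboxed_count S X.
Proof.
intros [_ HS] HY [HXY [B [HBY HBX]]]; apply filter_length_lt with B.
- intro C; destruct in_dec as [|H]; [easy|intros _].
  destruct in_dec as [H'|]; auto; destruct H; now apply HXY.
- apply HS; now apply (mcs_incl S Y).
- now destruct in_dec.
- now destruct in_dec.
Qed.

(** Each step lengthens the chain by one and boxes at least one more formula of [S], so the sum
    never grows. *)
Lemma chain_length (S : list form) (p : list (list form)) :
  subform_closed S -> chain S p ->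
  length p + unboxed_count S (hd [] p) <= Datatypes.S (length S).
Proof.
intros HS Hp; induction Hp as [X HX|X Y p HY HXY _ IH]; simpl in *.
- apply le_n_S, filter_length_le.
- assert (H := unboxed_count_lt S X Y HS HY HXY); lia.
Qed.

Lemma chain_in (S : list form) (p : list (list form)) (X : list form) :
  chain S p -> In X p -> mcs S X.
Proof.
intro Hp; induction Hp as [Y HY|Z Y p HY HZY _ IH].
- now intros [<-|[]].
- intros [<-|HX]; auto.
Qed.

Lemma chain_hd (S : list form) (p : list (list form)) : chain S p -> mcs S (hd [] p).
Proof. now intros [X HX|X Y q HY _ _]. Qed.

Lemma filters_finite {T : Type} (l : list T) :
  exists L, forall g, In (filter g l) L.
Proof.
induction l as [|x l [L IH]]; [exists [[]]; simpl; auto|].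
exists (L ++ map (cons x) L); intro g; simpl; rewrite in_app_iff.
destruct (g x); [right; apply in_map|left]; apply IH.
Qed.

Lemma bounded_lists_finite {T : Type} (L : list T) (n : nat) :
  exists l, forall p, incl p L -> length p <= n -> In p l.
Proof.
induction n as [|n [l IH]].
- exists [[]]; intros [|x p] _ Hp; simpl in *; auto; lia.
- exists ([] :: flat_map (fun x => map (cons x) l) L); intros [|x p] HL Hp; [now left|].
  right; apply in_flat_map; exists x; split; [apply HL; simpl; auto|].
  apply in_map, IH; [|simpl in Hp; lia].
  intros y Hy; apply HL; simpl; auto.
Qed.

(** [D] will involve consistency in GL, for which no decision procedure is given, so the list is
    filtered classically. *)
Lemma sig_finite {T : Type} (D : T -> Prop) (l : list T) :
  (forall x, D x -> In x l) -> exists l' : list {x | D x}, forall x, In x l'.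
Proof.
intro Hl.
assert (H : exists l' : list {x | D x}, forall x, In (proj1_sig x) l -> In x l').
{ clear Hl; induction l as [|y l [l' IH]]; [now exists []|].
  destruct (classic (D y)) as [Hy|Hy].
  - exists (exist _ y Hy :: l'); intros [x Hx] [E|H]; simpl in *; auto.
    left; subst; f_equal; apply proof_irrelevance.
  - exists l'; intros [x Hx] [E|H]; simpl in *; auto.
    now subst. }
destruct H as [l' H]; exists l'; intros [x Hx]; apply H, Hl, Hx.
Qed.

(** * The canonical pre-model on chains *)

Definition chain_frame (S X : list form) (HX : mcs S X) : vframe := {|
  world := {p | chain S p};
  world_inh := inhabits (exist _ [X] (chain_root S X HX));
  acc := fun p q => exists Y, proj1_sig q = Y :: proj1_sig p;
  val := fun p n => In (Atom n) (hd [] (proj1_sig p))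
|}.

(** A world with a theory has a nonempty chain as its tail, so the default [[]] is never reached. *)
Definition chain_premodel (S X : list form) (HX : mcs S X) :
    premodel (chain_frame S X HX) :=
  fun w => Theory (fun B => In (Box B) (hd [] (tl (proj1_sig (proj1_sig w)))))
                  (fun _ _ => False).

Lemma chain_frame_parent (S X : list form) (HX : mcs S X)
    (p q r : world (chain_frame S X HX)) :
  acc _ p r -> acc _ q r -> p = q.
Proof.
destruct p as [p Hp], q as [q Hq]; intros [Y HY] [Z HZ]; simpl in *.
rewrite HY in HZ; injection HZ as _ <-; f_equal; apply proof_irrelevance.
Qed.

(** Chains may start at any maximal consistent set, so the frame is a forest; [tree] only compares
    predecessors of a common world. *)
Lemma chain_frame_tree (S X : list form) (HX : mcs S X) : tree (chain_frame S X HX).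
Proof. intros p q r Hp Hq; left; now apply chain_frame_parent with r. Qed.

Lemma chain_frame_cwf (S X : list form) (HX : mcs S X) :
  subform_closed S -> converse_well_founded (chain_frame S X HX).
Proof.
intros HS [f Hf].
assert (Hn : forall n, n <= length (proj1_sig (f n))).
{ induction n as [|n IH]; [lia|]; destruct (Hf n) as [Y HY]; rewrite HY; simpl; lia. }
(* One more than the maximal chain length [1 + length S]. *)
specialize (Hn (2 + length S)).
assert (H := chain_length S _ HS (proj2_sig (f (2 + length S)))); lia.
Qed.

Lemma chain_premodel_bi_finite (S X : list form) (HX : mcs S X) :
  subform_closed S -> bi_finite (chain_premodel S X HX).
Proof.
intro HS; split.
- destruct (filters_finite S) as [L HL].
  destruct (bounded_lists_finite L (Datatypes.S (length S))) as [l Hl].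
  apply sig_finite with l; intros p Hp; apply Hl.
  + intros Y HY; destruct (chain_in S p Y Hp HY) as [[g ->] _]; apply HL.
  + assert (H := chain_length S p HS Hp); lia.
- intro w; split; [|easy].
  exists (unbox (hd [] (tl (proj1_sig (proj1_sig w))))).
  intro B; simpl; symmetry; apply unboxE.
Qed.

Lemma chain_frame_acc_lt (S X : list form) (HX : mcs S X)
    (p q : world (chain_frame S X HX)) :
  acc _ p q -> mcs_lt (hd [] (proj1_sig p)) (hd [] (proj1_sig q)).
Proof.
destruct p as [p Hp], q as [q Hq]; intros [Y HY]; simpl in *; subst q.
inversion Hq; subst; simpl; [inversion Hp|assumption].
Qed.

Lemma chain_frame_acc_plus (S X : list form) (HX : mcs S X)
    (p q : world (chain_frame S X HX)) (C : form) :
  acc_plus _ p q -> In (Box C) (hd [] (proj1_sig p)) ->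
  In C (hd [] (proj1_sig q)) /\ In (Box C) (hd [] (proj1_sig q)).
Proof.
intro Hpq; induction Hpq as [p q Hpq|p q r _ IH1 _ IH2]; intro HC.
- apply (chain_frame_acc_lt _ _ _ _ _ Hpq); auto.
- apply IH2, IH1, HC.
Qed.

Lemma chain_frame_step (S X : list form) (HX : mcs S X)
    (p : world (chain_frame S X HX)) (Y : list form) :
  mcs S Y -> mcs_lt (hd [] (proj1_sig p)) Y ->
  exists q : succ_world (chain_frame S X HX),
    acc _ p (proj1_sig q) /\ hd [] (proj1_sig (proj1_sig q)) = Y.
Proof.
destruct p as [p Hp]; intros HY HpY.
assert (Hq : chain S (Y :: p)).
{ destruct p as [|Z p]; [inversion Hp|]; now apply chain_step. }
set (p' := exist (chain S) p Hp : world (chain_frame S X HX)).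
set (q := exist (chain S) (Y :: p) Hq : world (chain_frame S X HX)).
assert (Hpq : acc (chain_frame S X HX) p' q) by now exists Y.
now exists (exist _ q (ex_intro _ p' Hpq)).
Qed.

Lemma chain_premodel_axioms (S X : list form) (HX : mcs S X)
    (p : world (chain_frame S X HX)) (w : succ_world (chain_frame S X HX)) (B : form) :
  acc _ p (proj1_sig w) ->
  derivable (chain_premodel S X HX w) B <-> In (Box B) (hd [] (proj1_sig p)).
Proof.
intros [Y HY].
assert (E : tl (proj1_sig (proj1_sig w)) = proj1_sig p) by now rewrite HY.
rewrite <- E; split.
- now intros [C HC|Gamma C []].
- intro HB; now apply der_axiom.
Qed.

(** * Truth lemma and completeness *)

Lemma chain_truth (S X : list form) (HX : mcs S X)
    (Q : premodel (chain_frame S X HX)) :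
  subform_closed S -> generated_by (chain_premodel S X HX) Q ->
  forall p B, In B S -> sat Q p B <-> In B (hd [] (proj1_sig p)).
Proof.
intros HS HQ p.
induction (cwf_well_founded_plus _ (chain_frame_cwf S X HX HS) p) as [p _ IH].
assert (Hp := chain_hd S _ (proj2_sig p)).
induction B as [n| |B IHB C IHC|B _]; intro HB.
- simpl; tauto.
- simpl; split; [easy|]; now apply mcs_Bot with S.
- destruct (proj1 HS B C HB) as [HB' HC'].
  simpl; rewrite (IHB HB'), (IHC HC'); symmetry; now apply mcs_Imp with S.
- split.
  + intro Hsat; apply NNPP; intro HBp.
    destruct (mcs_successor S _ B HS Hp HB HBp) as [Y [HY [HpY HBY]]].
    destruct (chain_frame_step S X HX p Y HY HpY) as [q [Hpq Eq]].
    apply HBY; rewrite <- Eq.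
    apply IH; [now apply t_step|now apply (proj2 HS)|].
    (* If [q] proved [B], then [B] would be true above [p], in particular at [q] itself, whose last
       set omits [B]. *)
    apply (generated_theorems_persist _ Q p q HQ); [| |auto|now apply t_step].
    * intros t Ht; now apply chain_frame_parent with (proj1_sig q).
    * intros C HC v Hpv; apply (chain_premodel_axioms S X HX p q) in HC; auto.
      (* With [Box C] at [p], every [v] above contains [C], true there by induction, and [Box C],
         making [C] an axiom of the children of [v]. *)
      destruct (chain_frame_acc_plus S X HX p v C Hpv HC) as [H1 H2]; split.
      -- apply IH; auto; apply (mcs_incl S _ (chain_hd S _ (proj2_sig v))), H1.
      -- intros u Hu; now apply (chain_premodel_axioms S X HX v u).
  + intros HBp w Hw; apply (proj2 (proj2 (proj1 HQ)) w).
    now apply (chain_premodel_axioms S X HX p w).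
Qed.

Theorem theorem4p6 (A : form) :
  (forall (F : vframe) (Q : premodel F),
      finitary Q -> forall w : world F, sat Q w A) ->
  derivable GL A.
Proof.
intro Hall; apply NNPP; intro HA.
assert (Hcons : consistent [Neg A]).
{ intro H; apply HA; apply GL_taut_consequence with [Imp (Neg A) Bot].
  - now intros D [<-|[]].
  - intros v Hv; assert (E := Hv _ (or_introl eq_refl)); simpl in E.
    now destruct (beval v A). }
destruct (mcs_exists (subforms A) _ Hcons) as [X [HX HXA]].
assert (HS := subforms_closed A).
assert (Htree := chain_frame_tree _ X HX).
set (Hcwf := chain_frame_cwf _ X HX HS).
set (P := chain_premodel (subforms A) X HX).
assert (HQ := gen_model_generated P Hcwf Htree).
apply (HXA A (subforms_refl A)); [simpl; auto|].
apply (chain_truth _ X HX _ HS HQ (exist _ [X] (chain_root _ X HX)) A (subforms_refl A)).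
apply Hall; exists P; split; [now apply chain_premodel_bi_finite|auto].
Qed.
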